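(* Consider the exterior Schwarzschild metric with mass $M>0$ on the region $r>r_s$, $0<\theta<\pi$, in coordinates $(x^0,x^1,x^2,x^3)=(t,r,\theta,\phi)$: $$ds^2=-\Big(1-\frac{r_s}{r}\Big)c^2dt^2+\Big(1-\frac{r_s}{r}\Big)^{-1}dr^2+r^2d\theta^2+r^2\sin^2\theta\,d\phi^2,\qquad r_s=\frac{2GM}{c^2},$$ where $G,c>0$ are constants. At every point of this region, $$\zeta=-\sqrt{\frac{K_1}{48}}$$ is an M-eigenvalue of the Riemann curvature tensor, where $K_1=R_{abcd}R^{abcd}=12\left(\frac{r_s}{r^3}\right)^2=\frac{48G^2M^2}{c^4r^6}$ is the Kretschmann curvature invariant.
   Context: Let $\nabla$ be the Levi-Civita connection of the Lorentzian metric $g$ and $\langle\cdot,\cdot\rangle=g$. Convention: $R(X,Y)=[\nabla_X,\nabla_Y]-\nabla_{[X,Y]}$, with components $R(\partial_k,\partial_l)\partial_j=R^i{}_{jkl}\partial_i$ and $R_{ijkl}=g_{ih}R^h{}_{jkl}$ (summation convention is used). M-eigenvalue (same definition as in the Riemannian case): a real number $\zeta$ is an M-eigenvalue of the Riemann curvature tensor at a point $p$ if there are tangent vectors $x,y$ at $p$ with $$R(y,x)x=\zeta y,\qquad R(x,y)y=\zeta x,\qquad \langle x,x\rangle=\langle y,y\rangle=1.$$ In components: $R^i{}_{jkl}x^jy^kx^l=\zeta y^i$, $R^i{}_{jkl}y^jx^ky^l=\zeta x^i$, $g_{ij}x^ix^j=g_{ij}y^iy^j=1$. *)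

(* Defs.v *)
From HB Require Import structures.
From mathcomp Require Import all_boot all_order all_algebra.
From mathcomp Require Import all_classical all_reals all_analysis.
From mathcomp Require Import lra.

Set Implicit Arguments.
Unset Strict Implicit.
Unset Printing Implicit Defensive.

Import Order.TTheory GRing.Theory Num.Theory.
Import numFieldNormedType.Exports.
Local Open Scope ring_scope.

(* Everything is written in one coordinate chart: points, tangent vectors (in
   the coordinate basis) and coordinate basis vectors are row vectors, a metric
   is the field of its Gram matrices, and a vector field is a function
   'rV[R]_n -> 'rV[R]_n.  All operators below only depend on the germs at [p]
   of their arguments, so fields given by formulas that make sense on an open
   region may be extended arbitrarily outside of it. *)

Section Chart.
Variables (R : realType) (n : nat).

Definition coord_vec (i : 'I_n) : 'rV[R]_n := delta_mx 0 i.

Definition pderiv (i : 'I_n) (f : 'rV[R]_n -> R) (p : 'rV[R]_n) : R :=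
  'D_(coord_vec i) f p.

Definition lie_bracket (X Y : 'rV[R]_n -> 'rV[R]_n) (p : 'rV[R]_n) : 'rV[R]_n :=
  \row_i \sum_j (X p 0 j * pderiv j (fun q => Y q 0 i) p
               - Y p 0 j * pderiv j (fun q => X q 0 i) p).

Variable g : 'rV[R]_n -> 'M[R]_n.

Definition metric_dot (p u v : 'rV[R]_n) : R :=
  \sum_i \sum_j g p i j * u 0 i * v 0 j.

(* [christoffel p i j k] is Gamma^i_{jk}. *)
Definition christoffel (p : 'rV[R]_n) (i j k : 'I_n) : R :=
  2^-1 * \sum_l invmx (g p) i l *
    (pderiv j (fun q => g q l k) p + pderiv k (fun q => g q l j) p
     - pderiv l (fun q => g q j k) p).

(* [nabla X Y] is the Levi-Civita covariant derivative of [Y] along [X]; see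
   [christoffelC] and [christoffel_metric] below for the vanishing of the
   torsion and the compatibility with the metric. *)
Definition nabla (X Y : 'rV[R]_n -> 'rV[R]_n) (p : 'rV[R]_n) : 'rV[R]_n :=
  \row_i (\sum_j X p 0 j * pderiv j (fun q => Y q 0 i) p
          + \sum_j \sum_k christoffel p i j k * X p 0 j * Y p 0 k).

Definition curvature (X Y Z : 'rV[R]_n -> 'rV[R]_n) (p : 'rV[R]_n) : 'rV[R]_n :=
  nabla X (nabla Y Z) p - nabla Y (nabla X Z) p - nabla (lie_bracket X Y) Z p.

(* [riemann p i j k l] is R^i_{jkl}, where R(d_k, d_l) d_j = R^i_{jkl} d_i. *)
Definition riemann (p : 'rV[R]_n) (i j k l : 'I_n) : R :=
  curvature (cst (coord_vec k)) (cst (coord_vec l)) (cst (coord_vec j)) p 0 i.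

(* R(u, v) w for tangent vectors at [p]. *)
Definition riemann_op (p u v w : 'rV[R]_n) : 'rV[R]_n :=
  \row_i \sum_j \sum_k \sum_l riemann p i j k l * w 0 j * u 0 k * v 0 l.

(* R_{ijkl} *)
Definition riemann_low (p : 'rV[R]_n) (i j k l : 'I_n) : R :=
  \sum_h g p i h * riemann p h j k l.

(* R^{ijkl} *)
Definition riemann_up (p : 'rV[R]_n) (i j k l : 'I_n) : R :=
  \sum_a \sum_b \sum_c \sum_d
    invmx (g p) i a * invmx (g p) j b * invmx (g p) k c * invmx (g p) l d
    * riemann_low p a b c d.

Definition kretschmann (p : 'rV[R]_n) : R :=
  \sum_i \sum_j \sum_k \sum_l riemann_low p i j k l * riemann_up p i j k l.

Definition M_eigenvalue (p : 'rV[R]_n) (zeta : R) : Prop :=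
  exists x y : 'rV[R]_n,
    [/\ riemann_op p y x x = zeta *: y, riemann_op p x y y = zeta *: x,
        metric_dot p x x = 1 & metric_dot p y y = 1].

Lemma christoffelC p i j k : (forall q, (g q)^T = g q) ->
  christoffel p i j k = christoffel p i k j.
Proof.
move=> gT; rewrite /christoffel; congr (_ * _); apply: eq_bigr => l _.
have -> : (fun q => g q j k) = (fun q => g q k j).
  by apply/funext => q; rewrite -{1}gT mxE.
by congr (_ * (_ - _)); rewrite addrC.
Qed.

Lemma christoffel_metric p i j k :
  (forall q, (g q)^T = g q) -> g p \in unitmx ->
  pderiv k (fun q => g q i j) p =
  \sum_l (christoffel p l k i * g p l j + christoffel p l k j * g p i l).
Proof.
move=> gT gU.
have gC q a b : g q a b = g q b a by rewrite -{1}gT mxE.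
pose T a b c := pderiv b (fun q => g q a c) p + pderiv c (fun q => g q a b) p
  - pderiv a (fun q => g q b c) p.
have lower a b c : \sum_l christoffel p l b c * g p a l = 2^-1 * T a b c.
  under eq_bigr do rewrite mulrC /christoffel mulrCA mulr_sumr.
  rewrite -mulr_sumr exchange_big /=; congr (_ * _).
  transitivity (\sum_m (g p *m invmx (g p)) a m * T m b c).
    apply: eq_bigr => m _; rewrite mxE mulr_suml.
    by apply: eq_bigr => l _; rewrite mulrA.
  rewrite mulmxV // (bigD1 a) //= mxE eqxx mul1r big1 ?addr0 // => m ma.
  by rewrite mxE eq_sym (negbTE ma) mul0r.
rewrite big_split /=.
under eq_bigr do rewrite [g p _ _]gC.
rewrite !lower /T.
have E a b c : pderiv a (fun q => g q b c) p = pderiv a (fun q => g q c b) p.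
  by congr (pderiv _ _ _); apply/funext => q; exact: gC.
rewrite (E k j i) (E i j k) (E j k i); lra.
Qed.

End Chart.

(* Coordinates (x^0, x^1, x^2, x^3) = (t, r, theta, phi). *)
Definition schwarzschild_metric (R : realType) (c rs : R) (x : 'rV[R]_4) :
    'M[R]_4 :=
  let r := x 0 1 in
  let theta := x 0 2 in
  diag_mx (\row_i
    [:: - (1 - rs / r) * c ^+ 2; (1 - rs / r)^-1; r ^+ 2; r ^+ 2 * sin theta ^+ 2]`_i).

Definition schwarzschild_exterior (R : realType) (rs : R) (x : 'rV[R]_4) : Prop :=
  [/\ rs < x 0 1, 0 < x 0 2 & x 0 2 < pi].

(* Main.v *)
Require Import Defs.
From mathcomp Require Import all_boot all_order all_algebra.
From mathcomp Require Import all_classical all_reals all_analysis.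
From mathcomp Require Import ring.
Import Order.TTheory GRing.Theory Num.Theory.
Import numFieldNormedType.Exports.
Local Open Scope ring_scope.

(* The curvature operator of the Schwarzschild metric is diagonal in the planes
   of the static frame, with sectional curvatures rs / r^3 on (t, r) and
   (theta, phi), and - rs / (2 r^3) on the four other planes; that is,
   R^i_{jkl} = K_ij g_jj (delta_ik delta_jl - delta_il delta_jk).  Hence the
   Kretschmann scalar is 4 sum_{i < j} K_ij^2 = 12 (rs / r^3)^2, and the
   normalized coordinate vectors of r and theta, which span a spacelike plane of
   curvature - rs / (2 r^3), realize the M-eigenvalue. *)

(** * Diagonal matrices *)

Lemma invmx_diag (F : fieldType) n (d : 'rV[F]_n) :
  (forall i, d 0 i != 0) -> invmx (diag_mx d) = diag_mx (\row_i (d 0 i)^-1).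
Proof.
move=> d0; set D' := diag_mx (\row_i _).
have DD' : diag_mx d *m D' = 1%:M.
  apply/matrixP => i j; rewrite mulmx_diag !mxE.
  by case: eqVneq => [->|//]; rewrite divff.
by rewrite -[RHS]mul1mx -(mulVmx (proj1 (mulmx1_unit DD'))) -mulmxA DD' mulmx1.
Qed.

Lemma sum_diag_mx (F : pzRingType) n (d : 'rV[F]_n) (f : 'I_n -> F) i :
  \sum_h diag_mx d i h * f h = d 0 i * f i.
Proof.
rewrite (bigD1 i) //= big1 ?addr0 => [|h hi]; first by rewrite mxE eqxx.
by rewrite mxE eq_sym (negbTE hi) mul0r.
Qed.

(** * Christoffel symbols and curvature components in a chart *)

Section Chart.
Variables (R : realType) (n : nat).
Implicit Types (p : 'rV[R]_n) (f : 'rV[R]_n -> R).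

Lemma pderiv_cst (i : 'I_n) (a : R) p : pderiv i (fun=> a) p = 0.
Proof. by rewrite /pderiv derive_cst. Qed.

Lemma near_pderiv (i : 'I_n) f1 f2 p :
  (\forall q \near p, f1 q = f2 q) -> pderiv i f1 p = pderiv i f2 p.
Proof. exact: near_eq_derive. Qed.

(** Both derivatives are limits of the same difference quotient in [h], so partial derivatives
    become one-variable ones. *)
Lemma pderiv_line (i : 'I_n) f (phi : R -> R) p a :
  (forall h, f (h *: coord_vec R i + p) = phi (h + a)) ->
  pderiv i f p = 'D_1 phi a.
Proof.
move=> fphi; rewrite /pderiv /derive.
have fp : f p = phi a by rewrite -[a in RHS]add0r -fphi scale0r add0r.
suff -> : (fun h => h^-1 *: ((f \o shift p) (h *: coord_vec R i) - f p)) =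
    (fun h => h^-1 *: ((phi \o shift a) (h *: 1) - phi a)) by [].
by apply/funext => h /=; rewrite fphi fp [h *: 1]mulr1.
Qed.

Variable g : 'rV[R]_n -> 'M[R]_n.

Lemma nabla_coord_vec (k j : 'I_n) p :
  nabla g (cst (coord_vec R k)) (cst (coord_vec R j)) p =
  \row_i christoffel g p i k j.
Proof.
apply/rowP => i; rewrite !mxE big1 ?add0r => [|m _]; last first.
  by rewrite pderiv_cst mulr0.
rewrite (bigD1 k) //= (bigD1 j) //= !mxE !eqxx !mulr1 !big1 ?addr0 //.
  by move=> m mk; apply: big1 => l _; rewrite !mxE eqxx (negbTE mk) mulr0 mul0r.
by move=> m mj; rewrite !mxE eqxx (negbTE mj) mulr0.
Qed.

(** Coordinate fields commute, so the bracket term of the curvature drops out; the first covariant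
    derivative has Christoffel symbols as components, and the second differentiates them and adds
    the quadratic terms. *)
Lemma riemannE p (i j k l : 'I_n) :
  riemann g p i j k l =
  pderiv k (fun q => christoffel g q i l j) p
  - pderiv l (fun q => christoffel g q i k j) p
  + \sum_m (christoffel g p i k m * christoffel g p m l j
            - christoffel g p i l m * christoffel g p m k j).
Proof.
have nabE a b : nabla g (cst (coord_vec R a)) (cst (coord_vec R b)) =
    fun q => \row_h christoffel g q h a b.
  by apply/funext => q; exact: nabla_coord_vec.
have nab2 a b : nabla g (cst (coord_vec R a))
      (fun q => \row_h christoffel g q h b j) p 0 i =
    pderiv a (fun q => christoffel g q i b j) p
    + \sum_m christoffel g p i a m * christoffel g p m b j.
  rewrite mxE (bigD1 a) //= !mxE !eqxx mul1r big1 ?addr0 => [|m ma]; last first.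
    by rewrite !mxE (negbTE ma) andbF mul0r.
  congr (_ + _).
    by congr (pderiv _ _ _); apply/funext => q; rewrite mxE.
  rewrite (bigD1 a) //= [X in _ + X]big1 ?addr0 => [|m ma]; last first.
    by apply: big1 => ? _; rewrite !mxE (negbTE ma) andbF mulr0 mul0r.
  by apply: eq_bigr => m _; rewrite !mxE !eqxx mulr1.
have br0 : lie_bracket (cst (coord_vec R k)) (cst (coord_vec R l)) = fun=> 0.
  apply/funext => q; apply/rowP => h; rewrite !mxE /= [RHS]mxE big1 // => m _.
  by rewrite !pderiv_cst !mulr0 subrr.
have nab0 : nabla g (fun=> 0) (cst (coord_vec R j)) p = 0.
  apply/rowP => h; rewrite !mxE /= [RHS]mxE !big1 ?addr0 // => m _;
    last by rewrite mxE mul0r.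
  by apply: big1 => ? _; rewrite mxE mulr0 mul0r.
rewrite /riemann /curvature br0 nab0 subr0 !nabE.
by rewrite mxE [X in _ + X]mxE !nab2 sumrB opprD addrACA.
Qed.

Lemma riemann_anti p (i j k l : 'I_n) :
  riemann g p i j k l = - riemann g p i j l k.
Proof.
rewrite !riemannE opprD opprB -sumrN; congr (_ + _).
by apply: eq_bigr => m _; rewrite opprB.
Qed.

(** The inverse metric is diagonal too, so only [l = i] survives in the defining sum, and each
    remaining derivative carries a Kronecker delta. *)
Lemma christoffel_diag (d : 'rV[R]_n -> 'rV[R]_n) p (i j k : 'I_n) :
  (forall q, g q = diag_mx (d q)) -> (forall l, d p 0 l != 0) ->
  christoffel g p i j k =
  (2 * d p 0 i)^-1 *
    (pderiv j (fun q => d q 0 i) p *+ (i == k)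
     + pderiv k (fun q => d q 0 i) p *+ (i == j)
     - pderiv i (fun q => d q 0 j) p *+ (j == k)).
Proof.
move=> gd d0; rewrite /christoffel gd invmx_diag // invfM -mulrA; congr (_ * _).
have pE a b m : pderiv m (fun q => g q a b) p =
    pderiv m (fun q => d q 0 a) p *+ (a == b).
  case: eqVneq => [->|ab]; rewrite ?mulr1n ?mulr0n.
    by congr (pderiv _ _ _); apply/funext => q; rewrite gd !mxE eqxx.
  rewrite -(pderiv_cst m 0 p); congr (pderiv _ _ _).
  by apply/funext => q; rewrite gd !mxE (negbTE ab).
rewrite (bigD1 i) //= big1 ?addr0 => [|l li].
  by rewrite !mxE eqxx !pE.
by rewrite !mxE eq_sym (negbTE li) mul0r.
Qed.

End Chart.

(** * Derivatives of functions of r and theta *)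

Lemma pderiv12 (R : realType) (F : R -> R -> R) (p : 'rV[R]_4) (j : 'I_4) d1 d2 :
  is_derive (p 0 1) 1 (F ^~ (p 0 2)) d1 ->
  is_derive (p 0 2) 1 (F (p 0 1)) d2 ->
  pderiv j (fun q => F (q 0 1) (q 0 2)) p =
  [:: 0; d1; d2; 0]`_j.
Proof.
move=> F1 F2.
have [ej|[ej|[ej|ej]]] : j = 0 \/ j = 1 \/ j = 2 \/ j = 3.
  by case: j => [[|[|[|[|//]]]] ?];
    [left|right; left|do 2 right; left|do 3 right]; exact: val_inj.
(* Moving along t, and likewise along phi in the last case, leaves r and theta fixed: the
   restriction to the line is constant. *)
- rewrite (@pderiv_line _ _ _ _ (fun=> F (p 0 1) (p 0 2)) p 0) ?ej ?derive_cst //.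
  by move=> h; rewrite !mxE !mulr0 !add0r.
- rewrite (@pderiv_line _ _ _ _ (F ^~ (p 0 2)) p (p 0 1)) ?ej ?derive_val //.
  by move=> h; rewrite !mxE mulr0 mulr1 !add0r.
- rewrite (@pderiv_line _ _ _ _ (F (p 0 1)) p (p 0 2)) ?ej ?derive_val //.
  by move=> h; rewrite !mxE mulr0 mulr1 !add0r.
- rewrite (@pderiv_line _ _ _ _ (fun=> F (p 0 1) (p 0 2)) p 0) ?ej ?derive_cst //.
  by move=> h; rewrite !mxE !mulr0 !add0r.
Qed.

(* [is_derive] at [R] without its class status: typeclass resolution diverges
   on the rational expressions below. *)
Definition has_deriv {R : realType} (f : R -> R) (x d : R) : Prop :=
  is_derive x 1 f d.

Section HasDeriv.
Variables (R : realType) (f g : R -> R) (x df dg : R).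

Lemma has_deriv_eq : has_deriv f x df -> df = dg -> has_deriv f x dg.
Proof. by move=> ? <-. Qed.

Lemma has_deriv_cst (a : R) : has_deriv (fun=> a) x 0.
Proof. exact: is_derive_cst. Qed.

Lemma has_deriv_id : has_deriv (fun y : R => y) x 1.
Proof. exact: is_derive_id. Qed.

Lemma has_deriv_sin : has_deriv (fun y : R => sin y) x (cos x).
Proof. exact: is_derive_sin. Qed.

Lemma has_deriv_cos : has_deriv (fun y : R => cos y) x (- sin x).
Proof. exact: is_derive_cos. Qed.

Lemma has_derivN : has_deriv f x df -> has_deriv (fun y => - f y) x (- df).
Proof. exact: is_deriveN. Qed.

Lemma has_derivD : has_deriv f x df -> has_deriv g x dg ->
  has_deriv (fun y => f y + g y) x (df + dg).
Proof. exact: is_deriveD. Qed.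

Lemma has_derivM : has_deriv f x df -> has_deriv g x dg ->
  has_deriv (fun y => f y * g y) x (f x * dg + g x * df).
Proof. exact: is_deriveM. Qed.

Lemma has_derivX n : has_deriv f x df ->
  has_deriv (fun y => f y ^+ n) x (n%:R * f x ^+ n.-1 * df).
Proof.
by move=> fdf; rewrite /has_deriv -exprfctE; exact: is_deriveX.
Qed.

Lemma has_derivV : f x != 0 -> has_deriv f x df ->
  has_deriv (fun y => (f y)^-1) x (- (df / f x ^+ 2)).
Proof.
move=> fx0 fdf; have -> : - (df / f x ^+ 2) = - f x ^- 2 *: df.
  by rewrite /GRing.scale /= mulNr mulrC.
exact: is_deriveV.
Qed.

End HasDeriv.

(** Recursion on the syntax of the function. Constants are matched first, so that subterms free of
    the variable are not expanded; the inverse rule leaves a nonvanishing side goal. *)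
Ltac has_deriv_rec :=
  lazymatch goal with
  | |- has_deriv (fun=> ?a) _ _ => exact: has_deriv_cst
  | |- has_deriv (fun y => y) _ _ => exact: has_deriv_id
  | |- has_deriv (fun y => sin y) _ _ => exact: has_deriv_sin
  | |- has_deriv (fun y => cos y) _ _ => exact: has_deriv_cos
  | |- has_deriv (fun y => - @?f y) _ _ =>
      apply: (@has_derivN _ f); has_deriv_rec
  | |- has_deriv (fun y => @?f y + @?g y) _ _ =>
      apply: (@has_derivD _ f g); has_deriv_rec
  | |- has_deriv (fun y => @?f y * @?g y) _ _ =>
      apply: (@has_derivM _ f g); has_deriv_rec
  | |- has_deriv (fun y => @?f y ^+ _) _ _ =>
      apply: (@has_derivX _ f); has_deriv_rec
  | |- has_deriv (fun y => (@?f y)^-1) _ _ =>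
      apply: (@has_derivV _ f); [ | has_deriv_rec ]
  end.

(** The derivative is first an existential variable, filled in by the rules; its equality with the
    expected formula is left as a final goal. *)
Ltac compute_deriv := eapply has_deriv_eq; [ has_deriv_rec | ]; rewrite ?/=.

(** * Metric coefficients and Christoffel symbols of the Schwarzschild metric *)

Section Schwarzschild.
Variables (R : realType) (c rs : R).
Hypotheses (c_gt0 : 0 < c) (rs_gt0 : 0 < rs).
Let g := schwarzschild_metric c rs.

(** The arguments r and theta are separate, as [pderiv12] expects, and indices are in [nat], so that
    case analyses reduce by computation. *)
Definition schw_coef (r th : R) (i : nat) : R :=
  [:: - (1 - rs / r) * c ^+ 2; (1 - rs / r)^-1; r ^+ 2; r ^+ 2 * sin th ^+ 2]`_i.

(** Derivatives of [schw_coef] along d_j. Entry (1, 1) comes from writing g_11 as r / (r - rs). *)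
Definition schw_dcoef (j : nat) (r th : R) (i : nat) : R :=
  match j, i with
  | 1, 0 => - (rs / r ^+ 2) * c ^+ 2
  | 1, 1 => - (rs / (r - rs) ^+ 2)
  | 1, 2 => 2 * r
  | 1, 3 => 2 * r * sin th ^+ 2
  | 2, 3 => 2 * r ^+ 2 * sin th * cos th
  | _, _ => 0
  end.

Definition schw_gamma (i j k : nat) (r th : R) : R :=
  match i, j, k with
  | 0, 0, 1 | 0, 1, 0 => rs / (2 * r * (r - rs))
  | 1, 0, 0 => c ^+ 2 * rs * (r - rs) / (2 * r ^+ 3)
  | 1, 1, 1 => - (rs / (2 * r * (r - rs)))
  | 1, 2, 2 => rs - r
  | 1, 3, 3 => (rs - r) * sin th ^+ 2
  | 2, 1, 2 | 2, 2, 1 | 3, 1, 3 | 3, 3, 1 => r^-1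
  | 2, 3, 3 => - (sin th * cos th)
  | 3, 2, 3 | 3, 3, 2 => cos th / sin th
  | _, _, _ => 0
  end.

(* [schw_dgamma m i j k] is the derivative of [schw_gamma i j k] along d_m. *)
Definition schw_dgamma (m i j k : nat) (r th : R) : R :=
  match m, i, j, k with
  | 1, 0, 0, 1 | 1, 0, 1, 0 => - (rs * (2 * r - rs) / (2 * (r * (r - rs)) ^+ 2))
  | 1, 1, 0, 0 => c ^+ 2 * rs * (3 * rs - 2 * r) / (2 * r ^+ 4)
  | 1, 1, 1, 1 => rs * (2 * r - rs) / (2 * (r * (r - rs)) ^+ 2)
  | 1, 1, 2, 2 => - 1
  | 1, 1, 3, 3 => - sin th ^+ 2
  | 2, 1, 3, 3 => 2 * (rs - r) * sin th * cos th
  | 1, 2, 1, 2 | 1, 2, 2, 1 | 1, 3, 1, 3 | 1, 3, 3, 1 => - r ^- 2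
  | 2, 2, 3, 3 => 2 * sin th ^+ 2 - 1
  | 2, 3, 2, 3 | 2, 3, 3, 2 => - sin th ^- 2
  | _, _, _, _ => 0
  end.

(* Sectional curvature of the coordinate plane (i, j), for i != j; the diagonal
   values are junk, always multiplied by 0 below. *)
Definition schw_sec (i j : nat) (r : R) : R :=
  match i, j with
  | 0, 1 | 1, 0 | 2, 3 | 3, 2 => rs / r ^+ 3
  | _, _ => - (rs / (2 * r ^+ 3))
  end.

Lemma exterior_neq0 p : schwarzschild_exterior rs p ->
  [/\ p 0 1 != 0, p 0 1 - rs != 0 & sin (p 0 2) != 0].
Proof.
case=> rsr th0 thpi; have r0 := lt_trans rs_gt0 rsr.
split; first by rewrite gt_eqF.
- by rewrite gt_eqF // subr_gt0.
- by rewrite gt_eqF // sin_gt0_pi // th0.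
Qed.

(** The region is open. This lets the closed form of the Christoffel symbols, valid only on the
    region, be differentiated. *)
Lemma near_exterior p : schwarzschild_exterior rs p ->
  \forall q \near p, schwarzschild_exterior rs q.
Proof.
case=> rsr th0 thpi.
have co (j : 'I_4) : {for p, continuous (fun q : 'rV[R]_4 => q 0 j)}.
  exact: coord_continuous.
have n1 := cvgr_gt _ (co 1) _ rsr.
have n2 := cvgr_gt _ (co 2) _ th0.
have n3 := cvgr_lt _ (co 2) _ thpi.
near=> q; split; near: q; [exact: n1|exact: n2|exact: n3].
Unshelve. all: by end_near.
Qed.

Lemma schw_coef_neq0 (r th : R) (i : 'I_4) :
  r != 0 -> r - rs != 0 -> sin th != 0 -> schw_coef r th i != 0.
Proof.
move=> r0 rrs s0; have h0 : 1 - rs / r != 0.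
  by rewrite -(divff r0) -mulrBl mulf_neq0 ?invr_eq0.
case: i => [[|[|[|[|//]]]] ?] /=.
- by rewrite mulf_neq0 ?oppr_eq0 // expf_neq0 // gt_eqF.
- by rewrite invr_eq0.
- by rewrite expf_neq0.
- by rewrite mulf_neq0 // expf_neq0.
Qed.

Lemma has_deriv_schw_coef (r th : R) (i : 'I_4) :
  r != 0 -> r - rs != 0 -> sin th != 0 ->
  has_deriv (fun r => schw_coef r th i) r (schw_dcoef 1 r th i) /\
  has_deriv (fun th => schw_coef r th i) th (schw_dcoef 2 r th i).
Proof.
move=> r0 rrs s0; have h0 : 1 - rs / r != 0.
  by rewrite -(divff r0) -mulrBl mulf_neq0 ?invr_eq0.
case: i => [[|[|[|[|//]]]] ?] /=; split; rewrite /schw_coef /schw_dcoef /=.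
- by compute_deriv => //; field.
- by compute_deriv.
- by compute_deriv => //; field; rewrite ?r0 ?rrs.
- by compute_deriv.
- by compute_deriv; ring.
- by compute_deriv.
- by compute_deriv; ring.
- by compute_deriv; ring.
Qed.

Lemma has_deriv_schw_gamma (r th : R) (i j k : 'I_4) :
  r != 0 -> r - rs != 0 -> sin th != 0 ->
  has_deriv (fun r => schw_gamma i j k r th) r (schw_dgamma 1 i j k r th) /\
  has_deriv (fun th => schw_gamma i j k r th) th (schw_dgamma 2 i j k r th).
Proof.
move=> r0 rrs s0.
have n2 : 2 != 0 :> R by rewrite pnatr_eq0.
(* The only trigonometric identity needed; [field: cs] works modulo it. *)
have cs : cos th * cos th = 1 - sin th * sin th by rewrite -!expr2 cos2sin2.
case: i => [[|[|[|[|//]]]] ?]; case: j => [[|[|[|[|//]]]] ?];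
  case: k => [[|[|[|[|//]]]] ?]; split; rewrite /schw_gamma /schw_dgamma /=;
  try exact: has_deriv_cst; compute_deriv; rewrite ?mulf_neq0 ?expf_neq0 //.
all: by field: cs; rewrite ?r0 ?rrs ?s0.
Qed.

Let d (q : 'rV[R]_4) : 'rV[R]_4 := \row_i schw_coef (q 0 1) (q 0 2) i.

Let gd q : g q = diag_mx (d q).
Proof. by []. Qed.

Lemma christoffelE p (i j k : 'I_4) : schwarzschild_exterior rs p ->
  christoffel g p i j k = schw_gamma i j k (p 0 1) (p 0 2).
Proof.
move=> /exterior_neq0[r0 rrs s0]; have d0 l : d p 0 l != 0.
  by rewrite mxE schw_coef_neq0.
have dE m l : pderiv m (fun q => d q 0 l) p = schw_dcoef m (p 0 1) (p 0 2) l.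
  have -> : (fun q => d q 0 l) = fun q => schw_coef (q 0 1) (q 0 2) l.
    by apply/funext => q; rewrite mxE.
  have [D1 D2] := has_deriv_schw_coef _ _ l r0 rrs s0.
  rewrite (@pderiv12 _ (fun r th => schw_coef r th l) p m _ _ D1 D2).
  by case: m => [[|[|[|[|//]]]] ?].
rewrite (christoffel_diag _ _ _ _ _ _ _ _ gd) // !dE mxE.
have n2 : 2 != 0 :> R by rewrite pnatr_eq0.
have c0 : c != 0 by rewrite gt_eqF.
move: (p 0 1) (p 0 2) r0 rrs s0 => r th r0 rrs s0.
case: i => [[|[|[|[|//]]]] ?]; case: j => [[|[|[|[|//]]]] ?];
  case: k => [[|[|[|[|//]]]] ?];
  rewrite /schw_coef /schw_dcoef /schw_gamma -val_eqE /=
    ?(mulr0n, mulr1n, addr0, add0r, subr0, oppr0, mulr0) //.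
all: by field; rewrite ?r0 ?rrs ?s0 ?c0.
Qed.

(** * The Riemann tensor *)

(** The right-hand side of [riemannE] on the explicit tables. Taking [k < l] leaves 96 index cases,
    each a rational identity in r, sin and cos. *)
Lemma schw_gamma_curvature (i j k l : nat) (r th : R) :
  (i < 4)%N -> (j < 4)%N -> (k < l)%N -> (l < 4)%N ->
  r != 0 -> r - rs != 0 -> sin th != 0 ->
  schw_dgamma k i l j r th - schw_dgamma l i k j r th
  + \sum_(0 <= m < 4) (schw_gamma i k m r th * schw_gamma m l j r th
                       - schw_gamma i l m r th * schw_gamma m k j r th) =
  schw_sec i j r * schw_coef r th j
  * (((i == k) && (j == l))%:R - ((i == l) && (j == k))%:R).
Proof.
move=> i4 j4 kl l4 r0 rrs s0; rewrite unlock /=.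
have n2 : 2 != 0 :> R by rewrite pnatr_eq0.
have cs : cos th * cos th = 1 - sin th * sin th by rewrite -!expr2 cos2sin2.
rewrite /schw_gamma /schw_dgamma /schw_sec /schw_coef.
(* Sine and cosine become indeterminates tied only by [cs], which makes the goals purely
   algebraic. *)
move: (sin th) (cos th) s0 cs => s co s0 cs.
do 4 ?[case: i i4 => [|i] // i4]; do 4 ?[case: j j4 => [|j] // j4];
  do 4 ?[case: l l4 kl => [|l] // l4 kl];
  do 3 ?[case: k kl => [|k] // kl]; rewrite /=.
all: by field: cs; rewrite ?r0 ?rrs ?s0.
Qed.

Lemma riemann_schwarzschild p (i j k l : 'I_4) : schwarzschild_exterior rs p ->
  riemann g p i j k l =
  schw_sec i j (p 0 1) * schw_coef (p 0 1) (p 0 2) j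
  * (((i == k) && (j == l))%:R - ((i == l) && (j == k))%:R).
Proof.
move=> extp; have [r0 rrs s0] := exterior_neq0 _ extp.
have dE m a b e : pderiv m (fun q => christoffel g q a b e) p =
    schw_dgamma m a b e (p 0 1) (p 0 2).
  rewrite (@near_pderiv _ _ _ _ (fun q => schw_gamma a b e (q 0 1) (q 0 2)));
    last first.
    by apply: filterS (near_exterior _ extp) => q; exact: christoffelE.
  have [D1 D2] := has_deriv_schw_gamma _ _ a b e r0 rrs s0.
  rewrite (@pderiv12 _ (fun r th => schw_gamma a b e r th) p m _ _ D1 D2).
  by case: m => [[|[|[|[|//]]]] ?].
(* Both sides are antisymmetric in [k] and [l], and both vanish when [k = l]. *)
wlog kl : k l / (k < l)%N => [hlt|].
  case: (ltngtP k l) => [||/val_inj <-]; first exact: hlt.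
    by move=> /hlt lk; rewrite riemann_anti lk -mulrN opprB.
  rewrite riemannE subrr add0r subrr mulr0.
  by apply: big1 => m _; rewrite subrr.
rewrite riemannE !dE; under eq_bigr do rewrite !christoffelE //.
have := schw_gamma_curvature i j k l _ _ (ltn_ord i) (ltn_ord j) kl
  (ltn_ord l) r0 rrs s0.
by rewrite big_mkord.
Qed.

Lemma invmx_schwarzschild p : schwarzschild_exterior rs p ->
  invmx (g p) = diag_mx (\row_i (schw_coef (p 0 1) (p 0 2) i)^-1).
Proof.
move=> /exterior_neq0[r0 rrs s0].
rewrite [g p](_ : _ = diag_mx (\row_i schw_coef (p 0 1) (p 0 2) i)) //.
rewrite invmx_diag => [|l]; last by rewrite mxE schw_coef_neq0.
by congr diag_mx; apply/rowP => l; rewrite !mxE.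
Qed.

(** * The Kretschmann scalar *)

Lemma kretschmann_schwarzschild p : schwarzschild_exterior rs p ->
  kretschmann g p = 12 * (rs / p 0 1 ^+ 3) ^+ 2.
Proof.
move=> extp; have [r0 rrs s0] := exterior_neq0 _ extp.
pose G (i : 'I_4) := schw_coef (p 0 1) (p 0 2) i.
pose K (i j : 'I_4) := schw_sec i j (p 0 1).
pose e (i j k l : 'I_4) : R :=
  ((i == k) && (j == l))%:R - ((i == l) && (j == k))%:R.
have G0 i : G i != 0 by exact: schw_coef_neq0.
have lowE i j k l : riemann_low g p i j k l = G i * (K i j * G j * e i j k l).
  by rewrite /riemann_low sum_diag_mx mxE riemann_schwarzschild.
have upE i j k l : riemann_up g p i j k l =
    (G i)^-1 * ((G j)^-1 * ((G k)^-1 * ((G l)^-1 * riemann_low g p i j k l))).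
  rewrite /riemann_up invmx_schwarzschild //.
  (* The inverse metric is diagonal, so the four sums collapse from the innermost outwards. *)
  under eq_bigr do under eq_bigr do under eq_bigr do
    (under eq_bigr do rewrite -!mulrA; rewrite -!mulr_sumr sum_diag_mx).
  under eq_bigr do under eq_bigr do rewrite -!mulr_sumr sum_diag_mx.
  under eq_bigr do rewrite -!mulr_sumr sum_diag_mx.
  by rewrite sum_diag_mx !mxE.
have termE i j k l : riemann_low g p i j k l * riemann_up g p i j k l =
    K i j ^+ 2 * e i j k l ^+ 2.
  (* Where [e] is nonzero, {k, l} = {i, j}; hence all metric coefficients cancel in the product of
     the lowered and raised components. *)
  have eG : e i j k l / (G k * G l) = e i j k l / (G i * G j).
    rewrite /e; do 4 case: eqVneq => [?|_]; subst=> //=;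
    by rewrite ?subrr ?mul0r //; congr (_ / _); rewrite mulrC.
  rewrite upE lowE; transitivity
    (G i * K i j * G j * e i j k l * K i j * (e i j k l / (G k * G l))).
    by field; rewrite !G0.
  by rewrite eG; field; rewrite !G0.
(* For [i != j] only (k, l) = (i, j) and (j, i) contribute, each 1; for [i = j] the two deltas
   cancel, which discards the junk diagonal of [K]. *)
have sum_e i j : \sum_k \sum_l e i j k l ^+ 2 = 2 *+ (i != j).
  rewrite !big_ord_recl !big_ord0 /e -!val_eqE.
  by case: i => [[|[|[|[|//]]]] ?]; case: j => [[|[|[|[|//]]]] ?] /=; ring.
transitivity (\sum_i \sum_j K i j ^+ 2 * (2 *+ (i != j))).
  apply: eq_bigr => i _; apply: eq_bigr => j _; rewrite -sum_e mulr_sumr.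
  by apply: eq_bigr => k _; rewrite mulr_sumr; apply: eq_bigr => l _.
(* Of the 12 ordered pairs, 4 have curvature rs / r^3 and 8 have minus half of it: 2 (4 + 8 / 4) =
   12. *)
by rewrite !big_ord_recl !big_ord0 /K -!val_eqE /=; field.
Qed.

(** * The M-eigenvalue *)

Lemma M_eigenvalue_schwarzschild p : schwarzschild_exterior rs p ->
  M_eigenvalue g p (- (rs / (2 * p 0 1 ^+ 3))).
Proof.
move=> extp; have [r0 rrs s0] := exterior_neq0 _ extp.
set r := p 0 1 in r0 rrs *.
have h0 : 0 < 1 - rs / r.
  have [rsr _ _] := extp.
  by rewrite subr_gt0 ltr_pdivrMr ?mul1r // (lt_trans rs_gt0).
(* The factors are g_rr^(-1/2) and g_theta,theta^(-1/2); both coefficients are positive since r >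
   rs, so each vector has square norm +1. *)
exists (Num.sqrt (1 - rs / r) *: coord_vec R 1), (r^-1 *: coord_vec R 2).
have dotE u v : metric_dot g p u v =
    \sum_(i < 4) schw_coef r (p 0 2) i * u 0 i * v 0 i.
  apply: eq_bigr => i _; rewrite -[RHS]mulrA.
  by under eq_bigr do rewrite -mulrA; rewrite sum_diag_mx mxE.
(* Only one triple of summation indices meets the supports of the vectors, and the surviving
   component lies along d_j. For a unit vector, a^2 g_ii = 1 and the factor is the sectional
   curvature. *)
have opE (i j : 'I_4) a b : i != j ->
    riemann_op g p (b *: coord_vec R j) (a *: coord_vec R i) (a *: coord_vec R i) =
    (a ^+ 2 * schw_sec j i r * schw_coef r (p 0 2) i) *: (b *: coord_vec R j).
  move=> ij; apply/rowP => h; rewrite !mxE.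
  rewrite (bigD1 i) //= [X in _ + X]big1 ?addr0 => [|m mi]; last first.
    apply: big1 => k _; apply: big1 => l _.
    by rewrite !mxE (negbTE mi) andbF !(mulr0, mul0r).
  rewrite (bigD1 j) //= [X in _ + X]big1 ?addr0 => [|m mj]; last first.
    by apply: big1 => l _; rewrite !mxE (negbTE mj) andbF !(mulr0, mul0r).
  rewrite (bigD1 i) //= [X in _ + X]big1 ?addr0 => [|m mi]; last first.
    by rewrite !mxE (negbTE mi) andbF !(mulr0, mul0r).
  rewrite riemann_schwarzschild // !mxE !eqxx /= (negbTE ij) andbF subr0 andbT.
  case: eqVneq => [->|hj]; rewrite ?mulr0n ?mulr0 ?mul0r //.
  by ring.
split.
- rewrite opE //=; congr (_ *: _); rewrite sqr_sqrtr ?ltW //.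
  by rewrite /schw_sec /schw_coef /=; field; rewrite r0.
- rewrite opE //=; congr (_ *: _); rewrite /schw_sec /schw_coef /=.
  by field.
- rewrite dotE (bigD1 1) //= big1 ?addr0 => [|i i1]; last first.
    by rewrite !mxE (negbTE i1) andbF !(mulr0, mul0r).
  rewrite !mxE eqxx mulr1 -mulrA -expr2 sqr_sqrtr ?ltW // /schw_coef /=.
  by rewrite mulVf // gt_eqF.
- rewrite dotE (bigD1 2) //= big1 ?addr0 => [|i i1]; last first.
    by rewrite !mxE (negbTE i1) andbF !(mulr0, mul0r).
  by rewrite !mxE eqxx mulr1 /schw_coef /=; field.
Qed.

End Schwarzschild.

Theorem proposition4 (R : realType) (G c M : R) (G_gt0 : 0 < G) (c_gt0 : 0 < c)
    (M_gt0 : 0 < M) (p : 'rV[R]_4) :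
  let rs := 2 * G * M / c ^+ 2 in
  let g := schwarzschild_metric c rs in
  let r := p 0 1 in
  let K1 := kretschmann g p in
  schwarzschild_exterior rs p ->
  [/\ K1 = 12 * (rs / r ^+ 3) ^+ 2,
      K1 = 48 * G ^+ 2 * M ^+ 2 / (c ^+ 4 * r ^+ 6) &
      M_eigenvalue g p (- Num.sqrt (K1 / 48))].
Proof.
move=> rs g r K1 extp.
have rs_gt0 : 0 < rs by rewrite divr_gt0 ?exprn_gt0 // !mulr_gt0.
have r_gt0 : 0 < r by case: extp => rsr _ _; exact: lt_trans rs_gt0 rsr.
have K1E : K1 = 12 * (rs / r ^+ 3) ^+ 2 by exact: kretschmann_schwarzschild.
split=> //.
  by rewrite K1E /rs; field; rewrite !gt_eqF.
(* As 12 / 48 = 1 / 4, the radicand is a perfect square, and its root is the positive number rs / (2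
   r^3). *)
rewrite K1E (_ : _ / 48 = (rs / (2 * r ^+ 3)) ^+ 2); last first.
  by field; rewrite gt_eqF.
rewrite sqrtr_sqr ger0_norm; first exact: M_eigenvalue_schwarzschild.
by rewrite ltW // divr_gt0 // mulr_gt0 // exprn_gt0.
Qed.
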